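(* For all integers $n,m\ge0$ and every $x$, \[ \sum_{i=0}^{n}\mathcal{T}_n^i(x)\,(-q)^{n-i}\,\mathcal{B}_{i,m}^{(k)}(a,q,L;x)=\frac{(a+m)^k\,n!\,l^{n+a}}{a^k(n+a+m)^k}. \]
   Context: Let $k\ge1$ be an integer, $a,q,l_1,\dots,l_k$ nonzero reals, $l=\prod l_i$, $L=(l_1,\dots,l_k)$; denominators $a+j$ ($j\ge0$ integer) assumed nonzero and $l^{a+i}$ means $l^al^i$. Let $\operatorname{Li}_k(w;b)=\sum_{n\ge1}\frac{w^n}{(n+b)^k}$. The generalized $m$-poly-Bernoulli polynomials are defined by \[ \frac{q\,l^{a-1}(a+m)^k}{a^k}\,\frac{\operatorname{Li}_k\!\big(\frac{l}{q}(1-e^{-qz});a+m-1\big)}{e^{qzx}(1-e^{-qz})}=\sum_{n\ge0}\mathcal{B}_{n,m}^{(k)}(a,q,L;x)\frac{z^n}{n!}. \] The weighted Stirling numbers of the first kind are defined by $\frac{1}{i!}\frac{(\ln(1+z))^i}{(1+z)^x}=\sum_{n\ge i}\mathcal{T}_n^i(x)\frac{z^n}{n!}$. *)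

(* Defs.v *)
From HB Require Import structures.
From mathcomp Require Export all_boot all_order all_algebra.
From mathcomp Require Export boolp classical_sets reals exp trigo.
From mathcomp Require Export complex.

Set Implicit Arguments.
Unset Strict Implicit.
Unset Printing Implicit Defensive.

Import Order.TTheory GRing.Theory Num.Theory.
Local Open Scope ring_scope.
Local Open Scope complex_scope.

(* The ring K[[z]] of formal power series, in which both generating functions
   live. A record, so that the Cauchy product cannot be confused with the
   pointwise product on nat -> K. *)
Record fps (K : fieldType) := FPS { fcoef : nat -> K }.

Lemma fpsP (K : fieldType) (f g : fps K) : fcoef f =1 fcoef g -> f = g.
Proof. by case: f g => [f] [g] /= e; congr FPS; apply/funext. Qed.

HB.instance Definition _ (K : fieldType) := gen_eqMixin (fps K).
HB.instance Definition _ (K : fieldType) := gen_choiceMixin (fps K).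

Definition fps_zero (K : fieldType) : fps K := FPS (fun=> 0).
Definition fps_opp (K : fieldType) (f : fps K) : fps K :=
  FPS (fun n => - fcoef f n).
Definition fps_add (K : fieldType) (f g : fps K) : fps K :=
  FPS (fun n => fcoef f n + fcoef g n).

Lemma fps_addA (K : fieldType) : associative (@fps_add K).
Proof. by move=> f g h; apply: fpsP => n /=; rewrite addrA. Qed.
Lemma fps_addC (K : fieldType) : commutative (@fps_add K).
Proof. by move=> f g; apply: fpsP => n /=; rewrite addrC. Qed.
Lemma fps_add0 (K : fieldType) : left_id (@fps_zero K) (@fps_add K).
Proof. by move=> f; apply: fpsP => n /=; rewrite add0r. Qed.
Lemma fps_addN (K : fieldType) :
  left_inverse (@fps_zero K) (@fps_opp K) (@fps_add K).
Proof. by move=> f; apply: fpsP => n /=; rewrite addNr. Qed.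

HB.instance Definition _ (K : fieldType) := GRing.isZmodule.Build (fps K)
  (@fps_addA K) (@fps_addC K) (@fps_add0 K) (@fps_addN K).

Definition fpsC (K : fieldType) (c : K) : fps K :=
  FPS (fun n => if n == 0%N then c else 0).
Definition fps_mul (K : fieldType) (f g : fps K) : fps K :=
  FPS (fun n => \sum_(i < n.+1) fcoef f i * fcoef g (n - i)%N).

Lemma fcoef_mul (K : fieldType) (f g : fps K) (n : nat) :
  fcoef (fps_mul f g) n = \sum_(i < n.+1) fcoef f i * fcoef g (n - i)%N.
Proof. by []. Qed.

Definition fps_trunc (K : fieldType) (n : nat) (f : fps K) : {poly K} :=
  \poly_(i < n.+1) fcoef f i.

Lemma coef_fps_trunc (K : fieldType) (n i : nat) (f : fps K) :
  (i <= n)%N -> (fps_trunc n f)`_i = fcoef f i.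
Proof. by move=> lein; rewrite coef_poly ltnS lein. Qed.

Lemma fps_mul_trunc (K : fieldType) (n i : nat) (f g : fps K) : (i <= n)%N ->
  fcoef (fps_mul f g) i = (fps_trunc n f * fps_trunc n g)`_i.
Proof.
move=> lein; rewrite coefM fcoef_mul; apply: eq_bigr => j _.
have leji : (j <= i)%N by rewrite -ltnS.
rewrite !coef_fps_trunc //; first exact: leq_trans (leq_subr _ _) lein.
exact: leq_trans leji lein.
Qed.

Lemma fps_mulC (K : fieldType) : commutative (@fps_mul K).
Proof.
by move=> f g; apply: fpsP => n; rewrite !(@fps_mul_trunc _ n n) // mulrC.
Qed.

Lemma fps_mulA (K : fieldType) : associative (@fps_mul K).
Proof.
move=> f g h; apply: fpsP => n.
transitivity ((fps_trunc n f * (fps_trunc n g * fps_trunc n h))`_n).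
  rewrite coefM fcoef_mul; apply: eq_bigr => i _.
  have lein : (i <= n)%N by rewrite -ltnS.
  rewrite (coef_fps_trunc f lein); congr (_ * _).
  exact: fps_mul_trunc (leq_subr _ _).
rewrite mulrA coefM fcoef_mul; apply: eq_bigr => i _.
have lein : (i <= n)%N by rewrite -ltnS.
rewrite (coef_fps_trunc h (leq_subr i n)); congr (_ * _).
by apply/esym; exact: fps_mul_trunc lein.
Qed.

Lemma fps_mul1 (K : fieldType) : left_id (fpsC (1 : K)) (@fps_mul K).
Proof.
move=> f; apply: fpsP => n /=; rewrite big_ord_recl /= subn0 mul1r.
by rewrite big1 ?addr0 // => i _; rewrite mul0r.
Qed.

Lemma fps_mulDl (K : fieldType) : left_distributive (@fps_mul K) +%R.
Proof.
move=> f g h; apply: fpsP => n /=; rewrite -big_split /=.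
by apply: eq_bigr => i _; rewrite mulrDl.
Qed.

Lemma fps_oner_neq0 (K : fieldType) : fpsC (1 : K) != 0.
Proof.
by apply/eqP => /(congr1 (fun f => fcoef f 0%N)) /= /eqP; rewrite oner_eq0.
Qed.

HB.instance Definition _ (K : fieldType) :=
  GRing.Zmodule_isComNzRing.Build (fps K)
    (@fps_mulA K) (@fps_mulC K) (@fps_mul1 K) (@fps_mulDl K)
    (@fps_oner_neq0 K).

(* f / g is the series h with h * g = f: K[[z]] is a domain, so h is unique as
   soon as g != 0, and it may exist although g is not invertible. *)
Definition fps_div (K : fieldType) (f g : fps K) : fps K :=
  xget 0 [set h : fps K | h * g = f].

(* f(g(z)), for g without constant term: then g ^+ i contributes to the
   coefficient of z^n only for i <= n. *)
Definition fps_comp (K : fieldType) (f g : fps K) : fps K :=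
  FPS (fun n => \sum_(i < n.+1) fcoef f i * fcoef (g ^+ i) n).

(* e^{cz} *)
Definition fps_exp (K : fieldType) (c : K) : fps K :=
  FPS (fun n => c ^+ n / n`!%:R).

(* ln(1+z) *)
Definition fps_ln1p (K : fieldType) : fps K :=
  FPS (fun n => if n == 0%N then 0 else (-1) ^+ n.-1 / n%:R).

(* (1+z)^x = e^{x ln(1+z)} *)
Definition fps_pow1p (K : fieldType) (x : K) : fps K :=
  fps_comp (fps_exp x) (fps_ln1p K).

(* Li_k(w;b), as a series in w *)
Definition fps_Li (K : fieldType) (k : nat) (b : K) : fps K :=
  FPS (fun n => if n == 0%N then 0 else ((n%:R + b) ^+ k)^-1).

Definition wstirling1 (K : fieldType) (n i : nat) (x : K) : K :=
  n`!%:R * fcoef (fpsC (i`!%:R^-1) *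
                  fps_div (fps_ln1p K ^+ i) (fps_pow1p x)) n.

(* Principal value of l^a for a nonzero real l, possibly negative, and a real
   exponent a; this is why the polynomials below have complex values. *)
Definition rcpow (R : realType) (l a : R) : R[i] :=
  let t := a * (if l < 0 then pi else 0) in
  (`|l| `^ a)%:C * (cos t +i* sin t).

Definition lprod (R : realType) (k : nat) (L : k.-tuple R) : R :=
  \prod_(i < k) tnth L i.

Definition polyBernoulli_gf (R : realType) (m k : nat) (a q : R)
    (L : k.-tuple R) (x : R[i]) : fps R[i] :=
  let l := lprod L in
  let one_sub_exp := 1 - fps_exp (- q%:C) in
  fpsC (q%:C * (rcpow l a * l%:C^-1) * (a%:C + m%:R) ^+ k / a%:C ^+ k) *
  fps_div (fps_comp (fps_Li k (a%:C + m%:R - 1)) (fpsC (l%:C / q%:C) * one_sub_exp))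
          (fps_exp (q%:C * x) * one_sub_exp).

Definition polyBernoulli (R : realType) (n m k : nat) (a q : R)
    (L : k.-tuple R) (x : R[i]) : R[i] :=
  n`!%:R * fcoef (polyBernoulli_gf m a q L x) n.

(* Main.v *)
Require Import Defs.
From mathcomp Require Import ring.

Set Implicit Arguments.
Unset Strict Implicit.
Unset Printing Implicit Defensive.

Import Order.TTheory GRing.Theory Num.Theory.
Local Open Scope ring_scope.
Local Open Scope complex_scope.

(** Substitute [Z = - ln(1+z) / q] for [z] in the generating function of the
    poly-Bernoulli polynomials. Since [e^(-qZ) = 1 + z], it becomes a constant
    times [(1+z)^x Li_k(- (l/q) z) / (- z)]; multiplying by [(1+z)^(-x)], which
    on coefficients is exactly the sum against the weighted Stirling numbers,
    leaves the explicit series [Li_k(- (l/q) z) / (- z)]. *)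

(** * Coefficients of formal power series *)

Section FpsRing.
Variable K : fieldType.
Implicit Types (f g h : fps K) (c : K).

Definition fpsX : fps K := FPS (fun n => (n == 1%N)%:R).

Lemma fcoef1 n : fcoef (1 : fps K) n = (n == 0%N)%:R.
Proof. by case: n. Qed.

Lemma fcoefD f g n : fcoef (f + g) n = fcoef f n + fcoef g n.
Proof. by []. Qed.

Lemma fcoefN f n : fcoef (- f) n = - fcoef f n.
Proof. by []. Qed.

Lemma fcoefM f g n :
  fcoef (f * g) n = \sum_(i < n.+1) fcoef f i * fcoef g (n - i)%N.
Proof. by []. Qed.

Lemma fcoefCM c f n : fcoef (fpsC c * f) n = c * fcoef f n.
Proof.
rewrite fcoefM big_ord_recl /= subn0 big1 ?addr0 // => i _.
by rewrite mul0r.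
Qed.

Lemma fcoefXM0 f : fcoef (fpsX * f) 0 = 0.
Proof. by rewrite fcoefM big_ord1 mul0r. Qed.

Lemma fcoefXMS f n : fcoef (fpsX * f) n.+1 = fcoef f n.
Proof.
rewrite fcoefM big_ord_recl /= mul0r add0r big_ord_recl /= mul1r subSS subn0.
by rewrite big1 ?addr0 // => i _; rewrite mul0r.
Qed.

Lemma fcoefXn i n : fcoef (fpsX ^+ i) n = (n == i)%:R.
Proof.
elim: i n => [|i IHi] [|n]; rewrite ?expr0 ?fcoef1 // exprS.
  by rewrite fcoefXM0.
by rewrite fcoefXMS IHi.
Qed.

Lemma fpsCM c c' : fpsC (c * c') = fpsC c * fpsC c'.
Proof.
by apply: fpsP => n; rewrite fcoefCM /=; case: (n == 0%N); rewrite ?mulr0.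
Qed.

Lemma fpsCX c n : fpsC c ^+ n = fpsC (c ^+ n).
Proof. by elim: n => // n IHn; rewrite !exprS fpsCM IHn. Qed.

Lemma fcoefCXM c g i n : fcoef ((fpsC c * g) ^+ i) n = c ^+ i * fcoef (g ^+ i) n.
Proof. by rewrite exprMn fpsCX fcoefCM. Qed.

Lemma fcoef0_mul f g : fcoef (f * g) 0 = fcoef f 0 * fcoef g 0.
Proof. by rewrite fcoefM big_ord1. Qed.

Lemma fps_divisible_X f : fcoef f 0 = 0 -> {g | f = fpsX * g}.
Proof.
move=> f0; exists (FPS (fun n => fcoef f n.+1)); apply: fpsP => -[|n].
  by rewrite fcoefXM0.
by rewrite fcoefXMS.
Qed.

(** Factoring [g] as [fpsX * h] puts [fpsX ^+ i] in front of [g ^+ i]. This is why the truncated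
    sums in [fps_comp] lose nothing. *)
Lemma fcoef_exp_lt g i n : fcoef g 0 = 0 -> (n < i)%N -> fcoef (g ^+ i) n = 0.
Proof.
move=> /fps_divisible_X[h ->]; rewrite exprMn; move: (h ^+ i) => {h} h.
elim: i n => [|i IHi] [|n] // ltni; rewrite exprS -mulrA ?fcoefXM0 //.
by rewrite fcoefXMS IHi.
Qed.

(** [fps_div] picks a quotient, with default 0, so its defining equation holds once some quotient is
    exhibited. *)
Lemma fps_divK f g : (exists h, h * g = f) -> fps_div f g * g = f.
Proof.
by move=> h; rewrite /fps_div; case: xgetP => [? _ //|]; case: h => h e /(_ h).
Qed.

(** * Composition *)

Lemma fcoef_compM f g h n : fcoef g 0 = 0 ->
  fcoef (fps_comp f g * h) n = \sum_(i < n.+1) fcoef f i * fcoef (g ^+ i * h) n.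
Proof.
move=> g0; under [RHS]eq_bigr do rewrite fcoefM mulr_sumr.
rewrite exchange_big fcoefM /=; apply: eq_bigr => j _.
(* Coefficient [j] of the composite is a sum up to [j]; the terms added between [j] and [n]
   vanish. *)
rewrite mulr_suml (big_ord_widen n.+1 (fun i =>
  fcoef f i * fcoef (g ^+ i) j * fcoef h (n - j)%N)) //.
rewrite big_mkcond /=; apply: eq_bigr => i _; rewrite mulrA.
by case: ltnP => // lt_ji; rewrite fcoef_exp_lt // mulr0 mul0r.
Qed.

Lemma fcoef_comp0 f g : fcoef (fps_comp f g) 0 = fcoef f 0.
Proof. by rewrite /= big_ord1 mulr1. Qed.

Lemma fps_compD f g h : fps_comp (f + g) h = fps_comp f h + fps_comp g h.
Proof.
by apply: fpsP => n /=; rewrite -big_split; apply: eq_bigr => i _; rewrite mulrDl.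
Qed.

Lemma fps_compN f h : fps_comp (- f) h = - fps_comp f h.
Proof.
by apply: fpsP => n /=; rewrite -sumrN; apply: eq_bigr => i _; rewrite mulNr.
Qed.

Lemma fps_compC c h : fps_comp (fpsC c) h = fpsC c.
Proof.
apply: fpsP => n /=; rewrite big_ord_recl /= big1 ?addr0 => [|i _].
  by case: (n == 0%N); rewrite ?mulr1 ?mulr0.
by rewrite mul0r.
Qed.

Lemma fps_compX h : fcoef h 0 = 0 -> fps_comp fpsX h = h.
Proof.
move=> h0; apply: fpsP => -[|n] /=; first by rewrite big_ord1 mul0r h0.
rewrite big_ord_recl mul0r add0r big_ord_recl /= mul1r big1 ?addr0 // => i _.
by rewrite mul0r.
Qed.

Lemma fps_comp_id f : fps_comp f fpsX = f.
Proof.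
apply: fpsP => n /=; rewrite big_ord_recr /= big1 ?add0r => [|i _].
  by rewrite fcoefXn eqxx mulr1.
by rewrite fcoefXn gtn_eqF // mulr0.
Qed.

(** Both sides sum [fcoef f j * fcoef g i * fcoef (h ^+ (i + j)) n] over pairs; the left side groups
    them by [i + j], and pairs with [n < i + j] contribute zero. *)
Lemma fps_compM f g h : fcoef h 0 = 0 ->
  fps_comp (f * g) h = fps_comp f h * fps_comp g h.
Proof.
move=> h0; apply: fpsP => n; rewrite fcoef_compM // [LHS]/=.
under eq_bigr => i _.
  rewrite mulr_suml (big_ord_widen n.+1 (fun j =>
    fcoef f j * fcoef g (i - j)%N * fcoef (h ^+ i) n)) // big_mkcond /=; over.
rewrite exchange_big; apply: eq_bigr => j _.
rewrite [h ^+ j * _]mulrC fcoef_compM // mulr_sumr.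
rewrite -(big_mkord xpredT (fun i => if (j < i.+1)%N then
  fcoef f j * fcoef g (i - j)%N * fcoef (h ^+ i) n else 0)).
(* Terms with [i < j] are zero by the condition; the others are reindexed by [i - j]. *)
rewrite (@big_cat_nat _ _ _ j) //=; last exact: ltnW.
rewrite [X in X + _]big_nat_cond [X in X + _]big1 ?add0r; last first.
  by move=> i /andP[/andP[_ lt_ij] _]; rewrite ltnS leqNgt lt_ij.
rewrite -{1}[nat_of_ord j]add0n big_addn big_mkord.
rewrite -(big_mkord xpredT (fun i =>
  fcoef f j * (fcoef g i * fcoef (h ^+ i * h ^+ j) n))).
rewrite [RHS](@big_cat_nat _ _ _ (n.+1 - j)%N) ?leq_subr //.
rewrite [X in _ = _ + X]big_nat_cond [X in _ = _ + X]big1 ?addr0; last first.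
  move=> i /andP[/andP[le_i _] _]; rewrite -exprD fcoef_exp_lt ?mulr0 //.
  by rewrite addnC -leq_subLR.
rewrite big_mkord; apply: eq_bigr => i _.
by rewrite ltnS leq_addl addnK exprD; ring.
Qed.

Lemma fps_compXn f h i : fcoef h 0 = 0 ->
  fps_comp (f ^+ i) h = fps_comp f h ^+ i.
Proof.
move=> h0; elim: i => [|i IHi]; first exact: fps_compC.
by rewrite !exprS fps_compM ?IHi.
Qed.

Lemma fps_compA f g h : fcoef g 0 = 0 -> fcoef h 0 = 0 ->
  fps_comp (fps_comp f g) h = fps_comp f (fps_comp g h).
Proof.
move=> g0 h0; apply: fpsP => n.
under [RHS]eq_bigr do rewrite -fps_compXn //= mulr_sumr.
rewrite exchange_big /=; apply: eq_bigr => i _.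
rewrite mulr_suml (big_ord_widen n.+1 (fun j =>
  fcoef f j * fcoef (g ^+ j) i * fcoef (h ^+ i) n)) // big_mkcond /=.
apply: eq_bigr => j _; rewrite mulrA; case: ltnP => // lt_ij.
by rewrite [fcoef (g ^+ j) i]fcoef_exp_lt // mulr0 mul0r.
Qed.

Lemma fps_comp_scale f c g :
  fps_comp f (fpsC c * g) = fps_comp (FPS (fun n => fcoef f n * c ^+ n)) g.
Proof.
by apply: fpsP => n /=; apply: eq_bigr => i _; rewrite fcoefCXM mulrA.
Qed.

(* Compose the identity [(sum_n z^n) (1 - z) = 1] with [1 - f / f(0)]. *)
Lemma fps_invertible f : fcoef f 0 != 0 -> exists g, g * f = 1.
Proof.
move=> f0; pose geom : fps K := FPS (fun=> 1).
have geomE : geom * (1 - fpsX) = 1.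
  apply: fpsP => -[|n]; rewrite mulrC mulrBl mul1r fcoefD fcoefN.
    by rewrite fcoefXM0 subr0.
  by rewrite fcoefXMS /= subrr.
pose t := 1 - fpsC (fcoef f 0)^-1 * f.
have t0 : fcoef t 0 = 0 by rewrite fcoefD fcoefN fcoefCM mulVf //= subrr.
exists (fps_comp geom t * fpsC (fcoef f 0)^-1).
have := congr1 (fun F : fps K => fps_comp F t) geomE.
rewrite fps_compC fps_compM // => e; apply: etrans e.
rewrite -mulrA; congr (_ * _).
by rewrite fps_compD fps_compN fps_compC fps_compX // /t opprB addrC subrK.
Qed.

(** * Derivatives *)

Definition fps_deriv f : fps K := FPS (fun n => fcoef f n.+1 *+ n.+1).

(** Inherited from polynomials. The truncation is at [n.+1] because coefficient [n] of a derivative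
    reads coefficient [n.+1]. *)
Lemma fps_derivM f g :
  fps_deriv (f * g) = fps_deriv f * g + f * fps_deriv g.
Proof.
apply: fpsP => n; have truncD h i : (i <= n)%N ->
    ((fps_trunc n.+1 h)^`())`_i = fcoef (fps_deriv h) i.
  by move=> lein; rewrite coef_deriv coef_fps_trunc.
transitivity (((fps_trunc n.+1 f * fps_trunc n.+1 g)^`())`_n).
  by rewrite coef_deriv -fps_mul_trunc.
rewrite derivM coefD !coefM fcoefD !fcoefM.
have le_i (i : 'I_n.+1) : (i <= n)%N by rewrite -ltnS.
by congr (_ + _); apply: eq_bigr => i _;
  rewrite truncD ?coef_fps_trunc ?leq_subr ?leqW ?leq_subr.
Qed.

Lemma fps_derivXn f i : fps_deriv (f ^+ i.+1) = f ^+ i * fps_deriv f *+ i.+1.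
Proof.
elim: i => [|i IHi]; first by rewrite expr1 mul1r.
rewrite exprS fps_derivM IHi mulrnAr mulrA -exprS [fps_deriv f * _]mulrC.
by rewrite -mulrS.
Qed.

Lemma fcoefMn f i n : fcoef (f *+ i) n = fcoef f n *+ i.
Proof. by elim: i => // i IHi; rewrite !mulrS fcoefD IHi. Qed.

(** The chain rule reduces term by term to powers of [g]; the term [i = 0] drops out since 1 has no
    coefficient at [n.+1]. *)
Lemma fps_deriv_comp f g : fcoef g 0 = 0 ->
  fps_deriv (fps_comp f g) = fps_comp (fps_deriv f) g * fps_deriv g.
Proof.
move=> g0; apply: fpsP => n; rewrite fcoef_compM //= big_ord_recl /= mulr0 add0r.
rewrite -sumrMnl; apply: eq_bigr => i _.
have := congr1 (fun F : fps K => fcoef F n) (fps_derivXn g i); rewrite fcoefMn /= => e.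
by rewrite /bump /= add1n -mulrnAr e mulrnAr mulrnAl.
Qed.

End FpsRing.

(** * Exponential, logarithm and binomial series *)

Section ExpLog.
Variable K : numFieldType.
Implicit Types (c q x : K).

Lemma fcoef_exp0 c : fcoef (fps_exp c) 0 = 1.
Proof. by rewrite /= expr0 fact0 divr1. Qed.

Lemma fps_deriv_exp c : fps_deriv (fps_exp c) = fpsC c * fps_exp c.
Proof.
apply: fpsP => n; rewrite fcoefCM /= factS natrM exprS -mulr_natr.
by field; rewrite nat1r !pnatr_eq0 -lt0n fact_gt0.
Qed.

Lemma fps_deriv_eq0 (f : fps K) : fps_deriv f = 0 -> f = fpsC (fcoef f 0).
Proof.
move=> f'0; apply: fpsP => -[|n] //=.
by have := congr1 (fun F : fps K => fcoef F n) f'0 => /= /eqP; rewrite mulrn_eq0 => /eqP.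
Qed.

Lemma fps_expNM c : fps_exp c * fps_exp (- c) = 1.
Proof.
have /fps_deriv_eq0-> : fps_deriv (fps_exp c * fps_exp (- c)) = 0.
  rewrite fps_derivM !fps_deriv_exp.
  have -> : fpsC (- c) = - fpsC c.
    by apply: fpsP => n /=; case: (n == 0%N); rewrite ?oppr0.
  by ring.
by rewrite fcoef0_mul !fcoef_exp0 mulr1.
Qed.

Lemma fps_comp_exp_scale x c (g : fps K) :
  fps_comp (fps_exp x) (fpsC c * g) = fps_comp (fps_exp (x * c)) g.
Proof.
rewrite fps_comp_scale; congr fps_comp; apply: fpsP => n /=.
by rewrite exprMn mulrAC.
Qed.

Lemma fps_pow1pN x : fps_pow1p x * fps_pow1p (- x) = 1.
Proof. by rewrite /fps_pow1p -fps_compM // fps_expNM fps_compC. Qed.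

Lemma fps_deriv_ln1p : (1 + fpsX K) * fps_deriv (fps_ln1p K) = 1.
Proof.
have lnE n : fcoef (fps_deriv (fps_ln1p K)) n = (-1) ^+ n.
  by rewrite /= -[LHS]mulr_natr divfK // pnatr_eq0.
apply: fpsP => -[|n]; rewrite mulrDl mul1r fcoefD lnE.
  by rewrite fcoefXM0 addr0.
by rewrite fcoefXMS lnE exprS mulN1r addNr.
Qed.

(* The left side [E] satisfies [(1 + z) E' = E] and [E(0) = 1], which determines
   its coefficients. *)
Lemma fps_pow1p1 : fps_pow1p 1 = 1 + fpsX K.
Proof.
set E := fps_pow1p 1.
have E0 : fcoef E 0 = 1 by rewrite fcoef_comp0 fcoef_exp0.
have EE : (1 + fpsX K) * fps_deriv E = E.
  rewrite fps_deriv_comp // mulrCA fps_deriv_ln1p mulr1 fps_deriv_exp.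
  by rewrite [fpsC _ * _]mul1r.
have E1 : fcoef E 1 = 1.
  have := congr1 (fun F : fps K => fcoef F 0%N) EE.
  by rewrite mulrDl mul1r fcoefD fcoefXM0 addr0 E0.
have ES n : fcoef E n.+2 *+ n.+2 + fcoef E n.+1 *+ n.+1 = fcoef E n.+1.
  by have := congr1 (fun F : fps K => fcoef F n.+1) EE; rewrite mulrDl mul1r fcoefD fcoefXMS.
clearbody E; apply: fpsP => -[|[|n]]; rewrite fcoefD ?E0 ?E1 /= ?addr0 ?add0r //.
(* With [E_1 = 1], the coefficient of [z] gives [2 E_2 + 1 = 1]; afterwards each zero coefficient
   forces the next one to vanish. *)
elim: n => [|n IHn].
  have := ES 0%N; rewrite E1 -[RHS]add0r => /addIr/eqP.
  by rewrite mulrn_eq0 => /eqP.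
have /eqP := ES n.+1; rewrite IHn mul0rn addr0 mulrn_eq0.
by move/eqP.
Qed.

(** Trades division by [(1+z)^x] for multiplication by [(1+z)^(-x)], the shape that [fcoef_compM]
    handles. *)
Lemma wstirling1E n i x :
  wstirling1 n i x =
  n`!%:R * (i`!%:R^-1 * fcoef (fps_ln1p K ^+ i * fps_pow1p (- x)) n).
Proof.
rewrite /wstirling1 fcoefCM; congr (_ * (_ * fcoef _ _)).
have e : fps_div (fps_ln1p K ^+ i) (fps_pow1p x) * fps_pow1p x = fps_ln1p K ^+ i.
  apply: fps_divK; exists (fps_ln1p K ^+ i * fps_pow1p (- x)).
  by rewrite -mulrA [fps_pow1p (- x) * _]mulrC fps_pow1pN mulr1.
by rewrite -[X in _ = X * _]e -mulrA fps_pow1pN mulr1.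
Qed.

(** * Inversion *)

(** The series [1 - e^(-qz)] is [z u] with [u(0) = q], so the denominator is [z] times an invertible
    series. *)
Lemma fps_exp_div_exists (f : fps K) q x : q != 0 -> fcoef f 0 = 0 ->
  exists h, h * (fps_exp (q * x) * (1 - fps_exp (- q))) = f.
Proof.
move=> q0 /fps_divisible_X[v ->].
have /fps_divisible_X[u uE] : fcoef (1 - fps_exp (- q)) 0 = 0.
  by rewrite fcoefD fcoefN fcoef_exp0 /= subrr.
have u0 : fcoef u 0 != 0.
  have := congr1 (fun F : fps K => fcoef F 1%N) uE; rewrite fcoefXMS => <-.
  by rewrite fcoefD fcoefN /= expr1 divr1 add0r opprK.
have [w wE] := fps_invertible u0.
exists (v * w * fps_exp (- (q * x))); rewrite uE.
transitivity (fps_exp (q * x) * fps_exp (- (q * x)) * (w * u) * (fpsX K * v)).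
  by ring.
by rewrite fps_expNM wE !mul1r.
Qed.

(** With [Z = - ln(1+z) / q], the power [Z^i] carries [(-q)^(-i)], which merges with [(-q)^n] into
    [(-q)^(n-i)]; [i!] cancels the [1/i!] of the Stirling numbers. *)
Lemma sum_wstirling1_fcoef n q x (f : fps K) : q != 0 ->
  \sum_(0 <= i < n.+1) wstirling1 n i x * (- q) ^+ (n - i) * (i`!%:R * fcoef f i)
  = n`!%:R * (- q) ^+ n *
    fcoef (fps_comp f (fpsC (- q)^-1 * fps_ln1p K) * fps_pow1p (- x)) n.
Proof.
move=> q0; have Nq0 : - q != 0 by rewrite oppr_eq0.
rewrite fcoef_compM; last by rewrite fcoefCM mulr0.
rewrite mulr_sumr big_mkord; apply: eq_bigr => i _.
have lein : (i <= n)%N by rewrite -ltnS.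
rewrite wstirling1E exprMn fpsCX -[fpsC _ * _ * _]mulrA fcoefCM exprVn.
rewrite -[X in _ = _ * (- q) ^+ X * _](subnK lein) exprD.
by field; rewrite expf_neq0 // pnatr_eq0 -lt0n fact_gt0.
Qed.

(** Substituting [Z] sends [1 - e^(-qz)] to [-z] and [e^(qxz)] to [(1+z)^(-x)], the very factor
    multiplying the quotient [D]. The equation defining [D] thus becomes
    [-z D(Z) (1+z)^(-x) = f(-cz)]. *)
Lemma fcoef_comp_exp_div n q c x (f : fps K) : q != 0 -> fcoef f 0 = 0 ->
  fcoef (fps_comp
    (fps_div (fps_comp f (fpsC c * (1 - fps_exp (- q))))
             (fps_exp (q * x) * (1 - fps_exp (- q))))
    (fpsC (- q)^-1 * fps_ln1p K) * fps_pow1p (- x)) n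
  = - (fcoef f n.+1 * (- c) ^+ n.+1).
Proof.
move=> q0 f0; set D := fps_div _ _; set Z := fpsC _ * _.
have Z0 : fcoef Z 0 = 0 by rewrite fcoefCM mulr0.
have /fps_divK/(congr1 (fun F : fps K => fps_comp F Z)) : exists h,
    h * (fps_exp (q * x) * (1 - fps_exp (- q)))
    = fps_comp f (fpsC c * (1 - fps_exp (- q))).
  by apply: fps_exp_div_exists; rewrite // fcoef_comp0.
have expNq : fps_comp (1 - fps_exp (- q)) Z = - fpsX K.
  rewrite fps_compD fps_compN fps_compC fps_comp_exp_scale.
  rewrite mulfV ?oppr_eq0 // -/(fps_pow1p 1) fps_pow1p1.
  by rewrite opprD addrA subrr add0r.
rewrite -/D fps_compM // fps_compM // expNq fps_compA //; last first.
  by rewrite fcoefCM fcoefD fcoefN fcoef_exp0 /= subrr mulr0.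
rewrite fps_compM // fps_compC expNq fps_comp_exp_scale.
have -> : q * x * (- q)^-1 = - x by field.
rewrite -/(fps_pow1p (- x)) => e.
have {}e : fpsX K * (fps_comp D Z * fps_pow1p (- x)) =
    - fps_comp f (fpsC (- c) * fpsX K).
  have -> : fpsC (- c) * fpsX K = fpsC c * - fpsX K.
    by apply: fpsP => i; rewrite !fcoefCM fcoefN mulrN mulNr.
  by rewrite -e; ring.
(* Cancelling [z] amounts to reading the next coefficient, whence [n.+1] on the right. *)
by rewrite -fcoefXMS e fcoefN fps_comp_scale fps_comp_id.
Qed.

End ExpLog.

(** * Specialization to the polylogarithm series, with [c = l/q] *)

Theorem theorem18 (R : realType) (k : nat) (a q : R) (L : k.-tuple R)
    (hk : (1 <= k)%N) (ha : a != 0) (hq : q != 0)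
    (hL : forall i : 'I_k, tnth L i != 0)
    (haj : forall j : nat, a + j%:R != 0)
    (n m : nat) (x : R[i]) :
  \sum_(0 <= i < n.+1)
     wstirling1 n i x * (- q%:C) ^+ (n - i) * polyBernoulli i m a q L x
  = ((a%:C + m%:R) ^+ k * n`!%:R * (rcpow (lprod L) a * (lprod L)%:C ^+ n))
    / (a%:C ^+ k * (n%:R + a%:C + m%:R) ^+ k).
Proof.
have q0 : q%:C != 0 by rewrite -(rmorph0 (real_complex R)) (inj_eq (@complexI R)).
have l0 : (lprod L)%:C != 0.
  rewrite -(rmorph0 (real_complex R)) (inj_eq (@complexI R)).
  by apply/prodf_neq0 => i _; exact: hL.
rewrite /polyBernoulli sum_wstirling1_fcoef // /polyBernoulli_gf.
rewrite fps_compM; last by rewrite fcoefCM mulr0.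
rewrite fps_compC -[fpsC _ * _ * _]mulrA fcoefCM fcoef_comp_exp_div //.
rewrite -mulNr [fcoef (fps_Li _ _) _]/=.
(* The index [n.+1] absorbs the [-1] in the shift of the polylogarithm. *)
have -> : n.+1%:R + (a%:C + m%:R - 1) = n%:R + a%:C + m%:R :> R[i].
  by rewrite -natr1; ring.
(* One factor [-l/q] cancels the [q/l] of the prefactor and the minus sign; the other [n] turn
   [(-q)^n] into [l^n]. *)
rewrite invfM [(- (_ / _)) ^+ _]exprS.
have -> : (- ((lprod L)%:C / q%:C)) ^+ n = (lprod L)%:C ^+ n * (- q%:C) ^- n.
  by rewrite -mulrN -invrN exprMn exprVn.
have qn : (- q%:C) ^+ n != 0 by rewrite expf_neq0 // oppr_eq0.
set A := a%:C ^+ k; set B := (_ + _ + _) ^+ k; set C := (_ + _) ^+ k.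
(* These are common factors of both sides, [l^a] among them, and can be treated as variables. *)
move: (A^-1) (B^-1) C (rcpow _ _) qn => A' B' C r.
move: ((- q%:C) ^+ n) => Q qn.
by field; rewrite q0 l0 qn.
Qed.
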